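(* Let a combined non-degenerate finitely additive Markov chain be given on an arbitrary discrete space $(X,\Sigma_d)$, with Markov operator $A=A_{ca}+A_{pfa}$, and suppose that $A_{ca}V_{pfa}\subset V_{pfa}$. Then all invariant finitely additive measures of this Markov chain (and such measures always exist) are purely finitely additive, that is, $\Delta_{ba}=\Delta_{pfa}\neq\emptyset$ and $\Delta_{ca}=\emptyset$.
   Context: ''Arbitrary discrete space'' $(X,\Sigma_d)$: $X$ is an infinite set, $\Sigma_d=2^X$ is the sigma-algebra of all subsets of $X$, and the cardinality of $X$ is ''immeasurable'', meaning that every finite countably additive measure on $2^X$ that is zero on every one-point set is identically zero. $B(X,\Sigma_d)$ is the space of bounded $\Sigma_d$-measurable functions $X\to\mathbb R$. $ba(X,\Sigma_d)$ and $ca(X,\Sigma_d)$ are the spaces of bounded real-valued finitely additive, respectively countably additive, measures on $\Sigma_d$. A finitely additive measure $\mu\ge0$ is purely finitely additive if every countably additive measure $\lambda$ with $0\le\lambda\le\mu$ is identically zero; a signed measure is purely finitely additive if both components of its Jordan decomposition are. $pfa(X,\Sigma_d)$ is the space of bounded purely finitely additive measures. For $\ast\in\{ba,ca,pfa\}$, $V_\ast$ is the set of nonnegative $\mu\in\ast(X,\Sigma_d)$ with $\mu(X)\le1$. A finitely additive Markov chain is given by a finitely additive Markov kernel: a function $P(x,E)$, $x\in X$, $E\in\Sigma_d$, with $0\le P(x,E)\le1$, $P(\cdot,E)\in B(X,\Sigma_d)$ for all $E$, $P(x,\cdot)\in ba(X,\Sigma_d)$ and $P(x,X)=1$ for all $x$.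 It decomposes uniquely as $P(x,E)=P_{ca}(x,E)+P_{pfa}(x,E)$ with $P_{ca}(x,\cdot)\in ca(X,\Sigma_d)$, $P_{pfa}(x,\cdot)\in pfa(X,\Sigma_d)$ for all $x$. The operators on $ba(X,\Sigma_d)$ are $A\mu(E)=\int_X P(x,E)\,\mu(dx)$, $A_{ca}\mu(E)=\int_X P_{ca}(x,E)\,\mu(dx)$, $A_{pfa}\mu(E)=\int_X P_{pfa}(x,E)\,\mu(dx)$ (Radon integrals: the sup-norm continuous extension of the integral of simple functions), so $A=A_{ca}+A_{pfa}$. The chain is called combined if there are constants $0\le q_1,q_2\le1$, $q_1+q_2=1$, with $P_{ca}(x,X)=q_1$ and $P_{pfa}(x,X)=q_2$ for all $x\in X$; it is called non-degenerate if $0<q_1,q_2<1$. An invariant measure is a positive finitely additive measure $\mu$ with $A\mu=\mu$. For $\ast\in\{ba,ca,pfa\}$, $\Delta_\ast$ is the set of all nonzero $\mu\in V_\ast$ with $A\mu=\mu$. *)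

(* Defs.v *)
From mathcomp Require Import all_boot all_order all_algebra.
From mathcomp Require Import all_classical all_reals all_analysis.

Set Implicit Arguments.
Unset Strict Implicit.
Unset Printing Implicit Defensive.

Import Order.TTheory GRing.Theory Num.Theory.
Import numFieldNormedType.Exports.

Local Open Scope classical_set_scope.
Local Open Scope ring_scope.

(* Measures are real-valued set functions on all of [set T], quantified over and
   compared on every subset: the definitions below are meant for spaces whose
   sigma-algebra is the full power set. *)

Definition discrete_sigma_algebra d (T : measurableType d) : Prop :=
  forall E : set T, measurable E.

Section measures.
Context (R : realType) (d : measure_display) (T : measurableType d).
Implicit Types (mu lam : set T -> R) (f g : T -> R) (P Pca Ppfa : T -> set T -> R).

Definition immeasurable : Prop :=
  forall m : {finite_measure set T -> \bar R},
    (forall x, m [set x] = 0%E) -> forall E : set T, m E = 0%E.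

Definition bounded_measurable : set (T -> R) :=
  [set f : T -> R | measurable_fun [set: T] f /\ bounded_fun f].

Definition ba : set (set T -> R) :=
  [set mu : set T -> R | measure_function.additive (EFin \o mu) /\ bounded_fun mu].

Definition ca : set (set T -> R) :=
  [set mu : set T -> R | measure_function.sigma_additive (EFin \o mu) /\ bounded_fun mu].

Definition nonneg mu : Prop := forall E, 0 <= mu E.

(* Components of the Jordan decomposition of a bounded finitely additive
   measure; no Hahn decomposition is available in the finitely additive case. *)
Definition jordan_plus mu : set T -> R :=
  fun E => sup [set mu F | F in [set F | F `<=` E]].

Definition jordan_minus mu : set T -> R := jordan_plus (fun E => - mu E).

Definition purely_fa_nonneg mu : Prop :=
  forall lam, ca lam -> (forall E, 0 <= lam E <= mu E) -> lam = cst 0.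

Definition pfa : set (set T -> R) :=
  [set mu : set T -> R | [/\ ba mu, purely_fa_nonneg (jordan_plus mu)
              & purely_fa_nonneg (jordan_minus mu)]].

Definition simple_function : set (T -> R) :=
  [set g : T -> R | measurable_fun [set: T] g /\ finite_set (range g)].

Definition simple_integral mu g : R := fine (sintegral (EFin \o mu) g).

(* The sup-norm continuous extension of [simple_integral mu]: the limit of the
   integrals of simple functions g as g tends to f uniformly on T. *)
Definition radon_integral mu f : R :=
  lim (simple_integral mu g
         @[g --> within simple_function (nbhs (f : {uniform T -> R}))]).

Definition markov_operator P mu : set T -> R :=
  fun E => radon_integral mu (P ^~ E).

Record fa_markov_kernel P : Prop := FaMarkovKernel {
  fa_kernel_itv : forall x E, 0 <= P x E <= 1;
  fa_kernel_fun : forall E, bounded_measurable (P ^~ E);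
  fa_kernel_ba : forall x, ba (P x);
  fa_kernel_mass : forall x, P x [set: T] = 1 }.

Record kernel_decomposition P Pca Ppfa : Prop := KernelDecomposition {
  kernel_decompE : forall x E, P x E = Pca x E + Ppfa x E;
  kernel_decomp_ca : forall x, ca (Pca x);
  kernel_decomp_pfa : forall x, pfa (Ppfa x) }.

(* [Pca] and [Ppfa] stand for the components of the decomposed kernel. *)
Record combined Pca Ppfa (q1 q2 : R) : Prop := Combined {
  combined_q1 : 0 <= q1 <= 1;
  combined_q2 : 0 <= q2 <= 1;
  combined_sum : q1 + q2 = 1;
  combined_ca : forall x, Pca x [set: T] = q1;
  combined_pfa : forall x, Ppfa x [set: T] = q2 }.

Definition non_degenerate (q1 q2 : R) : Prop := 0 < q1 < 1 /\ 0 < q2 < 1.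

Definition V (W : set (set T -> R)) : set (set T -> R) :=
  [set mu : set T -> R | [/\ W mu, nonneg mu & mu [set: T] <= 1]].

Definition invariant_measure P mu : Prop :=
  [/\ ba mu, nonneg mu & markov_operator P mu = mu].

Definition Delta P (W : set (set T -> R)) : set (set T -> R) :=
  [set mu : set T -> R | [/\ V W mu, mu <> cst 0 & markov_operator P mu = mu]].

End measures.

(* Main.v *)
Require Import Defs.
From HB Require Import structures.
From mathcomp Require Import all_boot all_order all_algebra.
From mathcomp Require Import all_classical all_reals all_analysis.
From mathcomp Require Import finmap lra.

Set Implicit Arguments.
Unset Strict Implicit.
Unset Printing Implicit Defensive.

Import Order.TTheory GRing.Theory Num.Theory.
Import numFieldNormedType.Exports.

Local Open Scope classical_set_scope.
Local Open Scope ring_scope.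

(** On an immeasurable discrete space a countably additive measure is
determined by its point masses: its positive and negative parts are finite
countably additive measures, and a finite measure without atoms vanishes
([ca_ge0], [ca_eq0]). Consequently a bounded finitely additive measure is purely
finitely additive exactly when it vanishes on every point ([pfaP]), and the
whole statement becomes one about point masses.

Let mu be invariant. Put mu_a(E) for the sum of the point masses of mu in E;
it is finitely additive and 0 <= mu_a <= mu, so mu = mu_a + mu_p with mu_p >= 0
purely finitely additive. For a finite set G the component P_pfa(x, G) is zero,
so that P(., G) = P_ca(., G), and P_ca is nonnegative since its values at points
are those of P; hence 0 <= P(x, G) <= P_ca(x, X) = q1. By hypothesis A_ca mu_p
is purely finitely additive and so vanishes on G. Therefore

  mu(G) = A mu (G) = A_ca mu_a (G) + A_ca mu_p (G) <= q1 mu_a(X),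

and the supremum over the finite G gives mu_a(X) <= q1 mu_a(X). As q1 < 1, the
measure mu has no atoms ([invariant_pfa]).

An invariant probability exists for every finitely additive kernel: A maps
finitely additive probabilities to such, the Cesaro averages nu_n of an orbit
satisfy |A nu_n (E) - nu_n (E)| <= 1 / (n + 1), and their pointwise limit along
a free ultrafilter is again a finitely additive probability. The Radon integral
of a fixed bounded function commutes with that limit, because uniform
approximation by simple functions is uniform over all probabilities
([radon_integral_ultralimit]); so the limit is invariant.

Integration only ever involves nonnegative measures mu, for which the Radon
integral of a bounded f is the supremum of the integrals of the simple functions
below f, and differs from the integral of a simple g by at most
mu(X) sup |f - g| ([radon_integral_near]). *)

(** * Finitely additive set functions on a power set *)

Section charges.
Context (R : realType) (T : choiceType).
Implicit Types (mu nu : set T -> R) (A B E : set T).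

(** Additivity on two disjoint sets, for real values: on a power set this is
finite additivity of bounded measures, see [baP]. *)
Definition finadd mu := mu set0 = 0 /\
  forall A B, A `&` B = set0 -> mu (A `|` B) = mu A + mu B.

Lemma finadd_setD mu A B : finadd mu -> A `<=` B -> mu B = mu A + mu (B `\` A).
Proof.
move=> [_ muU] AB; rewrite -muU ?setDE; last by rewrite setICA setICr setI0.
by rewrite -setDE setDUK.
Qed.

Lemma finadd_le mu A B : finadd mu -> (forall E, 0 <= mu E) -> A `<=` B ->
  mu A <= mu B.
Proof. by move=> fmu mu0 AB; rewrite (finadd_setD fmu AB) lerDl. Qed.

(** A function of finite range cuts the space into finitely many fibers; every
computation with simple functions below adds up over such a partition. *)
Lemma finadd_fibers (V : choiceType) mu (k : T -> V) (s : seq V) (p : pred V) :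
  finadd mu -> uniq s ->
  mu [set x | (k x \in s) && p (k x)] =
  \sum_(v <- s | p v) mu (k @^-1` [set v]).
Proof.
move=> [mu0 muU]; elim: s => [_|v s IH /= /andP[vs us]].
  by rewrite big_nil -mu0; congr mu; rewrite -subset0 => x.
have IHs := IH us; rewrite big_cons -IHs; case: ifPn => pv.
  rewrite -muU; last by rewrite -subset0 => x [/= ->]; rewrite (negPf vs).
  congr mu; apply/seteqP; split=> x /=; rewrite inE.
    by case: eqP => [->|_ /= h]; [left|right].
  by case=> [->|/andP[-> ->]]; rewrite ?eqxx ?pv ?orbT.
congr mu; apply/seteqP; split=> x /=; rewrite inE.
  by case: eqP => [->|//]; rewrite (negPf pv) andbF.
by case/andP => -> ->; rewrite orbT.
Qed.

Lemma finaddD mu nu : finadd mu -> finadd nu -> finadd (fun E => mu E + nu E).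
Proof.
move=> [m0 mU] [n0 nU]; split=> [|A B AB]; first by rewrite m0 n0 addr0.
by rewrite mU// nU// addrACA.
Qed.

Lemma finaddZ c mu : finadd mu -> finadd (fun E => c * mu E).
Proof.
move=> [m0 mU]; split=> [|A B AB]; first by rewrite m0 mulr0.
by rewrite mU// mulrDr.
Qed.

Lemma finadd_finiteE mu E : finadd mu -> finite_set E ->
  mu E = \sum_(x <- fset_set E) mu [set x].
Proof.
move=> fmu fE; have := finadd_fibers id xpredT fmu (fset_uniq (fset_set E)).
move=> <-; congr mu; rewrite -[LHS](fset_setK fE).
by apply/seteqP; split=> x /=; rewrite andbT.
Qed.

Lemma finadd_finite0 mu E : finadd mu -> (forall x, mu [set x] = 0) ->
  finite_set E -> mu E = 0.
Proof. by move=> fmu mu1 fE; rewrite finadd_finiteE// big1. Qed.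

End charges.

(** * Countable and pure finite additivity by point masses *)

Section discrete.
Context (R : realType) (d : measure_display) (T : measurableType d).
Context (Td : discrete_sigma_algebra T).
Implicit Types (mu nu : set T -> R) (A B E : set T).

Lemma bounded_fun_leP (U : Type) (f : U -> R) :
  bounded_fun f <-> exists M : R, forall x, `|f x| <= M.
Proof.
split=> [[M [_ Mf]]|[M Mf]].
  by exists (M + 1) => x; apply: (Mf (M + 1)); rewrite ?ltrDl.
exists M; split; first exact: num_real.
by move=> N MN x _ /=; apply: le_trans (Mf x) (ltW MN).
Qed.

Lemma baP mu : ba mu <-> finadd mu /\ bounded_fun mu.
Proof.
suff H : measure_function.additive (EFin \o mu) <-> finadd mu.
  by split=> -[/H].
split=> [amu|[m0 mU]].
  have m0 : (EFin \o mu) set0 = 0%E.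
    have := amu (fun=> set0) (fun=> Td _) _ 0%N; rewrite !big_ord0; apply.
    exact: trivIset_set0.
  rewrite -semi_additiveE in amu; have /= a2 := (additive2P m0).1 amu.
  split=> [|A B AB]; first by case: m0.
  by have [] := a2 A B (Td _) (Td _) AB.
have m0' : (EFin \o mu) set0 = 0%E by rewrite /= m0.
rewrite -semi_additiveE; apply/(additive2P m0') => A B _ _ AB /=.
by rewrite mU// EFinD.
Qed.

(** Only the value at the empty set needs an argument: the constant sequence of
empty sets has converging partial sums [c *+ n], which forces [c = 0]. *)
Lemma ca_ba mu : ca mu -> ba mu.
Proof.
move=> [smu bmu]; split=> //; apply: sigma_additive_is_additive => //=.
have tr : trivIset [set: nat] (fun=> set0 : set T) by exact: trivIset_set0.
have := smu _ (fun=> Td _) tr.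
rewrite bigcup0//= => cv; congr EFin; move: (mu set0) cv => c cv.
have cvn : (fun n => c *+ n) @ \oo --> c.
  move/fine_cvgP : cv => [_]; apply: cvg_trans; apply: near_eq_cvg.
  by near=> n; rewrite /= sumEFin sumr_const_nat subn0.
have cv1 : (fun n => c *+ n.+1) @ \oo --> c by rewrite (cvg_shiftS (fun n => c *+ n)).
have := cvg_lim (@Rhausdorff R) (cvgB cv1 cvn); rewrite subrr => <-//.
rewrite (_ : _ - _ = cst c); first exact/esym/lim_cst.
by apply/funext => n; rewrite /= !fctE mulrSr addrAC subrr add0r.
Unshelve. all: by end_near. Qed.

Section countably_additive.
Context (lam : set T -> R) (cal : ca lam).

Let lam0 : (EFin \o lam) set0 = 0%E.
Proof. by have /baP[[/= -> _] _] := ca_ba cal. Qed.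

Let lam_fin E : measurable E -> (EFin \o lam) E \is a fin_num.
Proof. by []. Qed.

Let lam_sigma : semi_sigma_additive (EFin \o lam).
Proof. by rewrite semi_sigma_additiveE; case: cal. Qed.

#[local] HB.instance Definition _ :=
  isCharge.Build d T R (EFin \o lam) lam0 lam_fin lam_sigma.

(** The negative part in a Hahn decomposition of [lam] is a finite measure
without atoms, hence zero on an immeasurable space. *)
Lemma ca_ge0 : immeasurable R T -> (forall x, 0 <= lam [set x]) ->
  forall E, 0 <= lam E.
Proof.
move=> Timm lam1 E; have [Pos [Neg PN]] := Hahn_decomposition (EFin \o lam).
have neg0 : forall x, jordan_neg PN [set x] = 0%E.
  move=> x; apply/eqP; rewrite eq_le measure_ge0 andbT jordan_negE cjordan_negE.
  rewrite /crestr0 mem_set// leeNl oppe0 /crestr /=.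
  have [xN|xN] := pselect (Neg x).
    by rewrite setIidl ?lee_fin// => _ ->.
  have -> : [set x] `&` Neg = set0 by rewrite -subset0 => y [->].
  by move: lam0 => /= ->.
have := jordan_decomp PN (Td E).
rewrite /cadd /= cscaleN1; set j := (X in (_ - X)%E).
have -> : j = 0%E by exact: Timm (jordan_neg PN) neg0 E.
rewrite oppe0 adde0 => lamE.
by rewrite -lee_fin lamE measure_ge0.
Qed.

End countably_additive.

Lemma caN mu : ca mu -> ca (fun E => - mu E).
Proof.
move=> [smu /bounded_fun_leP[M muM]]; split; last first.
  by apply/bounded_fun_leP; exists M => E; rewrite normrN.
move=> F mF tF; have := smu F mF tF => /cvgeN /=.
apply: cvg_trans; apply: near_eq_cvg; near=> n => /=.
by rewrite !sumEFin -EFinN sumrN.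
Unshelve. all: by end_near. Qed.

Lemma ca_eq0 mu : immeasurable R T -> ca mu -> (forall x, mu [set x] = 0) ->
  mu = cst 0.
Proof.
move=> Timm camu mu1; apply/funext => E; apply/eqP; rewrite eq_le.
rewrite -oppr_ge0 (ca_ge0 (caN camu) Timm); last by move=> x; rewrite mu1 oppr0.
by rewrite (ca_ge0 camu Timm)// => x; rewrite mu1.
Qed.

Lemma ca_dirac (c : R) (a : T) : ca (fun E => c * \1_E a).
Proof.
split; last first.
  apply/bounded_fun_leP; exists `|c| => E.
  rewrite normrM -[leRHS]mulr1 ler_wpM2l// indicE.
  by case: (_ \in _); rewrite ?normr1 ?normr0.
move=> F mF tF.
have : measure_function.sigma_additive (\d_a : {measure set T -> \bar R}).
  exact: measure_sigma_additive.
move=> /(_ F mF tF) /(@cvgeZl _ _ _ _ _ (c%:E) isT) /=.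
rewrite diracE indicE EFinM.
apply: cvg_trans; apply: near_eq_cvg; near=> n => /=.
rewrite ge0_sume_distrr; last by move=> i _; exact: measure_ge0.
by apply: eq_bigr => i _; rewrite diracE indicE EFinM.
Unshelve. all: by end_near. Qed.

(** A positive point mass [c] at [x] gives the countably additive minorant
[c * \1_E x] of the positive part, which is then not purely finitely additive.
Conversely a countably additive minorant of a positive part without atoms has
no atoms, hence is zero by immeasurability. *)
Lemma pfaP mu : immeasurable R T ->
  pfa mu <-> ba mu /\ forall x, mu [set x] = 0.
Proof.
move=> Timm.
have jp (nu : set T -> R) : ba nu ->
    forall E F, F `<=` E -> nu F <= jordan_plus nu E.
  move=> [_ /bounded_fun_leP[M nuM]] E F FE; apply: ub_le_sup; last by exists F.
  by exists M => _ [G _ <-]; apply: le_trans (ler_norm _) (nuM G).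
have jp1 (nu : set T -> R) x : ba nu -> purely_fa_nonneg (jordan_plus nu) ->
    nu [set x] <= 0.
  move=> banu pnu; have /baP[[nu0 _] _] := banu.
  rewrite leNgt; apply/negP => nux.
  have lam0 : (fun E => nu [set x] * \1_E x) = cst 0.
    apply: pnu (ca_dirac _ _) _ => E.
    apply/andP; split.
      by rewrite mulr_ge0 ?(ltW nux)// indicE; case: (_ \in _).
    rewrite indicE; case: (boolP (x \in E)) => [/set_mem xE|_].
      by rewrite mulr1; apply: jp => // y ->.
    by rewrite mulr0 -nu0; apply: jp.
  have := congr1 (fun g => g [set x]) lam0.
  by rewrite /= indicE mem_set// mulr1 => nu0'; rewrite nu0' ltxx in nux.
have jp0 (nu : set T -> R) : ba nu -> (forall x, nu [set x] = 0) ->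
    purely_fa_nonneg (jordan_plus nu).
  move=> /baP[[nu0 _] _] nu1 lam calam lam01; apply: (ca_eq0 Timm calam) => x.
  have /andP[l0 l1] := lam01 [set x]; apply/eqP; rewrite eq_le l0 andbT.
  apply: le_trans l1 _; apply: sup_le_ub; first by exists (nu set0), set0.
  by move=> _ [F /subset_set1[]-> <-]; rewrite ?nu0 ?nu1.
have baN : ba mu -> ba (fun E => - mu E).
  move=> /baP[fmu /bounded_fun_leP[M muM]]; apply/baP; split.
    have := finaddZ (-1) fmu; congr finadd; apply/funext => E; exact: mulN1r.
  by apply/bounded_fun_leP; exists M => E; rewrite normrN.
split=> [[bamu p1 p2]|[bamu mu1]]; split=> //.
- move=> x; apply/eqP; rewrite eq_le (jp1 _ _ bamu)//= -oppr_le0.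
  exact: (jp1 _ _ (baN bamu)).
- exact: jp0.
- by apply: jp0 => // [|x]; [exact: baN | rewrite mu1 oppr0].
Qed.

End discrete.

(** * Integrals of simple functions *)

Section simple.
Context (R : realType) (d : measure_display) (T : measurableType d).
Context (Td : discrete_sigma_algebra T).
Implicit Types (mu nu : set T -> R) (A B E : set T) (f g h : T -> R).

(** The integral can be computed on any finite partition on whose blocks the
function is constant, not only on its own level sets. Two simple functions
can thus be compared on the common partition given by [fun x => (g x, h x)]. *)
Lemma simple_integralE (V : choiceType) mu (k : T -> V) (s : seq V)
    (phi : V -> R) : finadd mu -> uniq s -> (forall x, k x \in s) ->
  simple_integral mu (phi \o k) = \sum_(v <- s) phi v * mu (k @^-1` [set v]).
Proof.
move=> fmu us ks; rewrite /simple_integral /sintegral.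
have phiks x : phi (k x) \in undup (map phi s) by rewrite mem_undup map_f.
rewrite (@fsbigE _ _ _ _ _ (undup (map phi s))) ?undup_uniq//; last first.
  move=> r _ rs; rewrite /= (_ : _ @^-1` _ = set0).
    by case: fmu => -> _; rewrite mule0.
  by rewrite -subset0 => x /= kxr; rewrite -kxr phiks in rs.
rewrite (eq_bigl xpredT); last by move=> r; rewrite in_setT.
under eq_bigr do rewrite /= -EFinM.
rewrite sumEFin /= (eq_bigr (fun r => \sum_(v <- s | r == phi v)
  phi v * mu (k @^-1` [set v]))).
  rewrite (exchange_big_dep xpredT)//= [LHS]big_seq_cond [RHS]big_seq_cond.
  apply: eq_bigr => v /andP[vs _]; rewrite -big_filter filter_pred1_uniq.
  - by rewrite big_seq1.
  - exact: undup_uniq.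
  - by rewrite mem_undup map_f.
move=> r _; rewrite (eq_bigr (fun v => r * mu (k @^-1` [set v]))); last first.
  by move=> v /eqP ->.
rewrite -big_distrr/= -(finadd_fibers k (fun v => r == phi v))//; congr (_ * mu _).
by apply/seteqP; split=> x /=; rewrite ks eq_sym => /eqP.
Qed.

Lemma simpleP g : simple_function g <-> finite_set (range g).
Proof. by split=> [[]|fg]//; split=> // _ B _; exact: Td. Qed.

Lemma simple_enum (V : choiceType) (k : T -> V) : finite_set (range k) ->
  exists2 s : seq V, uniq s & forall x, k x \in s.
Proof.
move=> fk; exists (fset_set (range k)); first exact: fset_uniq.
by move=> x; rewrite in_fset_set// mem_set//; exists x.
Qed.

Lemma simple_pair_enum g h : simple_function g -> simple_function h ->
  exists2 s : seq (R * R), uniq s & forall x, (g x, h x) \in s.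
Proof.
move=> [_ fg] [_ fh]; apply: simple_enum.
apply: sub_finite_set (finite_setX fg fh) => _ [x _ <-] /=.
by split; exists x.
Qed.

Lemma finadd_setT (V : choiceType) mu (k : T -> V) (s : seq V) : finadd mu ->
  uniq s -> (forall x, k x \in s) ->
  mu setT = \sum_(v <- s) mu (k @^-1` [set v]).
Proof.
move=> fmu us ks; rewrite -(finadd_fibers k xpredT)//; congr mu.
by apply/seteqP; split=> x //=; rewrite ks.
Qed.

Lemma simple_integral_le mu g h c : finadd mu -> nonneg mu ->
  simple_function g -> simple_function h -> (forall x, g x <= h x + c) ->
  simple_integral mu g <= simple_integral mu h + c * mu setT.
Proof.
move=> fmu mu0 sg sh gh; have [s us ks] := simple_pair_enum sg sh.
(* Both functions factor through the pair map [fun x => (g x, h x)]. *)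
rewrite -[g]/(fst \o (fun x => (g x, h x))).
rewrite -[h in X in _ <= X]/(snd \o (fun x => (g x, h x))).
rewrite !(simple_integralE _ fmu us ks) (finadd_setT fmu us ks) big_distrr/=.
rewrite -big_split/=; apply: ler_sum => -[u v] _ /=; rewrite -mulrDl.
have [->|/set0P[x /= [gx hx]]] := eqVneq ((fun x => (g x, h x)) @^-1` [set (u, v)]) set0.
  by case: fmu => -> _; rewrite !mulr0.
by rewrite ler_wpM2r// -gx -hx.
Qed.

Lemma simple_integralD mu g h : finadd mu ->
  simple_function g -> simple_function h ->
  simple_integral mu (fun x => g x + h x) =
  simple_integral mu g + simple_integral mu h.
Proof.
move=> fmu sg sh; have [s us ks] := simple_pair_enum sg sh.
rewrite -[g in RHS]/(fst \o (fun x => (g x, h x))).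
rewrite -[h in RHS]/(snd \o (fun x => (g x, h x))).
rewrite -[fun x => g x + h x]/((fun p => p.1 + p.2) \o (fun x => (g x, h x))).
rewrite !(simple_integralE _ fmu us ks) -big_split/=.
by apply: eq_bigr => v _; rewrite mulrDl.
Qed.

Lemma simple_integralDm mu nu g : finadd mu -> finadd nu -> simple_function g ->
  simple_integral (fun E => mu E + nu E) g =
  simple_integral mu g + simple_integral nu g.
Proof.
move=> fmu fnu [_ /simple_enum[s us ks]]; rewrite -[g]/(id \o g).
rewrite !(simple_integralE _ _ us ks)//; last exact: finaddD.
by rewrite -big_split/=; apply: eq_bigr => v _; rewrite mulrDr.
Qed.

Lemma simple_integralZm c mu g : finadd mu -> simple_function g ->
  simple_integral (fun E => c * mu E) g = c * simple_integral mu g.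
Proof.
move=> fmu [_ /simple_enum[s us ks]]; rewrite -[g]/(id \o g).
rewrite !(simple_integralE _ _ us ks)//; last exact: finaddZ.
by rewrite big_distrr/=; apply: eq_bigr => v _; rewrite mulrCA.
Qed.

Lemma simple_functionD g h : simple_function g -> simple_function h ->
  simple_function (fun x => g x + h x).
Proof.
move=> [_ fg] [_ fh]; apply/simpleP.
apply: sub_finite_set (finite_image (fun p => p.1 + p.2) (finite_setX fg fh)).
by move=> _ [x _ <-]; exists (g x, h x) => //; split; exists x.
Qed.

Lemma simple_cst c : @simple_function R d T (cst c).
Proof.
apply/simpleP; apply: sub_finite_set (finite_set1 c) => _ [x _ <-] //.
Qed.

Lemma simple_integral_cst mu c : finadd mu ->
  simple_integral mu (cst c) = c * mu setT.
Proof.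
move=> fmu; rewrite -[cst c]/(cst c \o cst tt).
rewrite (@simple_integralE _ mu (cst tt) [:: tt])//.
by rewrite big_seq1; congr (_ * mu _); apply/seteqP; split.
Qed.

(** Rounding [f], whose values lie in [[-M, M]], down to the grid [e * i - M]. *)
Lemma simple_dense f e : bounded_fun f -> 0 < e ->
  exists2 g, simple_function g & forall x, `|f x - g x| <= e.
Proof.
move=> /bounded_fun_leP[M fM] e0.
pose n x := Num.truncn ((f x + M) / e).
have fM0 x : 0 <= (f x + M) / e.
  by have := fM x; rewrite ler_norml => /andP[? ?]; rewrite divr_ge0 ?(ltW e0)//; lra.
exists (fun x => (n x)%:R * e - M).
  apply/simpleP; apply: sub_finite_set (finite_image (fun i : nat => i%:R * e - M)
    (finite_II (Num.truncn ((M + M) / e)).+1)).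
  move=> _ [x _ <-]; exists (n x) => //=; rewrite ltnS.
  apply: le_truncn; rewrite ler_wpM2r ?invr_ge0 ?(ltW e0)// lerD2r.
  exact: le_trans (ler_norm _) (fM x).
move=> x; have /andP[] := truncn_itv (fM0 x).
rewrite -/(n x) ler_pdivlMr// ltr_pdivrMr// -natr1 mulrDl mul1r => h1 h2.
by rewrite ler_norml; apply/andP; split; lra.
Qed.

End simple.

(** * The Radon integral of a bounded function *)

Section radon.
Context (R : realType) (d : measure_display) (T : measurableType d).
Context (Td : discrete_sigma_algebra T).
Implicit Types (mu nu : set T -> R) (A B E : set T) (f g h : T -> R).

(** A candidate for the limit defining the Radon integral against a nonnegative
[mu]; the limit can then be proved by estimates only. *)
Definition lower_integral mu f : R :=
  sup [set simple_integral mu g |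
       g in [set g | simple_function g /\ forall x, g x <= f x]].

Lemma lower_integral_near mu f g (e : R) : finadd mu -> nonneg mu ->
  simple_function g -> (forall x, `|f x - g x| <= e) ->
  `|lower_integral mu f - simple_integral mu g| <= e * mu setT.
Proof.
move=> fmu mu0 sg fge.
have gf x : g x - e <= f x by have := fge x; rewrite ler_norml; lra.
have ub : ubound [set simple_integral mu g |
    g in [set g | simple_function g /\ forall x, g x <= f x]]
    (simple_integral mu g + e * mu setT).
  move=> _ [h [sh hf] <-]; apply: simple_integral_le => // x.
  by have := fge x; have := hf x; rewrite ler_norml; lra.
have lb : [set simple_integral mu g |
    g in [set g | simple_function g /\ forall x, g x <= f x]]
    (simple_integral mu g - e * mu setT).
  exists (fun x => g x + cst (- e) x); last first.
    rewrite simple_integralD//.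
    by rewrite simple_integral_cst// mulNr.
  by split=> //; apply: (simple_functionD Td) => //; exact: (simple_cst Td).
have l1 : simple_integral mu g - e * mu setT <= lower_integral mu f.
  by apply: ub_le_sup => //; eexists; exact: ub.
have l2 : lower_integral mu f <= simple_integral mu g + e * mu setT.
  by apply: sup_le_ub => //; eexists; exact: lb.
by rewrite ler_norml; apply/andP; split; lra.
Qed.

(** Unfolds the uniform structure of [{uniform T -> R}] into the sup-distance
used in the estimates. *)
Lemma nbhs_uniformP f (P : set (T -> R)) : nbhs (f : {uniform T -> R}) P <->
  exists2 e : R, 0 < e & forall g, (forall x, `|f x - g x| < e) -> P g.
Proof.
rewrite uniform_nbhs; split=> [[E [entE EP]]|[e e0 eP]].
  move: entE; rewrite -entourage_ballE => -[e /= e0 eE].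
  by exists e => // g fg; apply: EP => x _; apply: eE => /=; exact: fg.
exists [set xy : R * R | ball xy.1 e xy.2]; split.
  exact: (entourage_ball _ (PosNum e0)).
by move=> g fg; apply: eP => x; apply: fg.
Qed.

(** The filter of simple functions near [f] is proper by density, so the limit
is identified by the estimate of [lower_integral_near]. *)
Lemma radon_integralE mu f : finadd mu -> nonneg mu -> bounded_fun f ->
  radon_integral mu f = lower_integral mu f.
Proof.
move=> fmu mu0 bf; rewrite /radon_integral.
pose F := within (@simple_function R d T) (nbhs (f : {uniform T -> R})).
have FF : ProperFilter F.
  apply: Build_ProperFilter_ex => P /nbhs_uniformP[e e0 eP].
  have e20 : 0 < e / 2 by rewrite divr_gt0.
  have [g sg fg] := simple_dense Td bf e20; exists g; apply: eP => // x.
  by apply: le_lt_trans (fg x) _; rewrite ltr_pdivrMr// ltr_pMr// ltr1n.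
apply: (@cvg_lim _ (@Rhausdorff R) _ F FF (simple_integral mu)).
apply/cvgrPdist_le => e e0.
have m0 : 0 < mu setT + 1 by rewrite ltr_wpDl.
have e'0 : 0 < e / (mu setT + 1) by rewrite divr_gt0.
apply/nbhs_uniformP; exists (e / (mu setT + 1)) => // g fg sg.
apply: le_trans (lower_integral_near fmu mu0 sg (fun x => ltW (fg x))) _.
by rewrite mulrAC ler_pdivrMr// ler_wpM2l ?(ltW e0)// lerDl.
Qed.

Lemma radon_integral_near mu f g (e : R) : finadd mu -> nonneg mu -> bounded_fun f ->
  simple_function g -> (forall x, `|f x - g x| <= e) ->
  `|radon_integral mu f - simple_integral mu g| <= e * mu setT.
Proof. by move=> *; rewrite radon_integralE//; exact: lower_integral_near. Qed.

(** One good approximation for each precision determines the integral; all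
linearity properties follow from those of simple functions through this
criterion. *)
Lemma radon_integral_unique mu f (L C : R) : finadd mu -> nonneg mu -> bounded_fun f ->
  (forall e : R, 0 < e -> exists g, [/\ simple_function g,
    forall x, `|f x - g x| <= e & `|L - simple_integral mu g| <= e * C]) ->
  radon_integral mu f = L.
Proof.
move=> fmu mu0 bf LC; apply/eqP; rewrite -subr_eq0 -normr_le0.
apply/ler_addgt0Pl => e e0; rewrite addr0.
have m0 : 0 < mu setT + `|C| + 1 by rewrite ltr_wpDl// addr_ge0.
have e'0 : 0 < e / (mu setT + `|C| + 1) by rewrite divr_gt0.
have [g [sg fg h2]] := LC _ e'0.
have h1 := radon_integral_near fmu mu0 bf sg fg.
rewrite -[X in X - _](subrK (simple_integral mu g)) -addrA.
apply: le_trans (ler_normD _ _) _; rewrite (distrC _ L).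
apply: le_trans (lerD h1 h2) _; rewrite -mulrDr mulrAC ler_pdivrMr//.
by rewrite ler_wpM2l ?(ltW e0)//; have := ler_norm C; lra.
Qed.

Lemma radon_integralDm mu nu f : finadd mu -> nonneg mu -> finadd nu ->
  nonneg nu -> bounded_fun f ->
  radon_integral (fun E => mu E + nu E) f =
  radon_integral mu f + radon_integral nu f.
Proof.
move=> fmu mu0 fnu nu0 bf.
apply: (@radon_integral_unique _ _ _ (mu setT + nu setT)) => //.
- exact: finaddD.
- by move=> E; rewrite addr_ge0.
move=> e e0; have [g sg fg] := simple_dense Td bf e0; exists g; split=> //.
rewrite simple_integralDm// opprD addrACA.
apply: le_trans (ler_normD _ _) _; rewrite mulrDr.
by apply: lerD; exact: radon_integral_near.
Qed.

Lemma radon_integralZm c mu f : 0 <= c -> finadd mu -> nonneg mu ->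
  bounded_fun f ->
  radon_integral (fun E => c * mu E) f = c * radon_integral mu f.
Proof.
move=> c0 fmu mu0 bf.
apply: (@radon_integral_unique _ _ _ (c * mu setT)) => //.
- exact: finaddZ.
- by move=> E; rewrite mulr_ge0.
move=> e e0; have [g sg fg] := simple_dense Td bf e0; exists g; split=> //.
rewrite simple_integralZm// -mulrBr normrM (ger0_norm c0).
by rewrite mulrCA ler_wpM2l//; exact: radon_integral_near.
Qed.

Lemma radon_integralD mu f1 f2 : finadd mu -> nonneg mu ->
  bounded_fun f1 -> bounded_fun f2 ->
  radon_integral mu (fun x => f1 x + f2 x) =
  radon_integral mu f1 + radon_integral mu f2.
Proof.
move=> fmu mu0 bf1 bf2.
apply: (@radon_integral_unique _ _ _ (mu setT)) => //.
  have /bounded_fun_leP[M1 fM1] := bf1; have /bounded_fun_leP[M2 fM2] := bf2.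
  apply/bounded_fun_leP; exists (M1 + M2) => x.
  by apply: le_trans (ler_normD _ _) _; apply: lerD.
move=> e e0; have e20 : 0 < e / 2 by rewrite divr_gt0.
have [g1 sg1 fg1] := simple_dense Td bf1 e20.
have [g2 sg2 fg2] := simple_dense Td bf2 e20.
exists (fun x => g1 x + g2 x); split; first exact: (simple_functionD Td).
  move=> x; rewrite opprD addrACA [leRHS]splitr.
  by apply: le_trans (ler_normD _ _) _; apply: lerD.
rewrite simple_integralD// opprD addrACA [e]splitr mulrDl.
by apply: le_trans (ler_normD _ _) _; apply: lerD; exact: radon_integral_near.
Qed.

Lemma radon_integral_cst mu c : finadd mu -> nonneg mu ->
  radon_integral mu (cst c) = c * mu setT.
Proof.
move=> fmu mu0; apply/eqP; rewrite -subr_eq0 -normr_le0.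
rewrite -simple_integral_cst//.
have -> : 0 = 0 * mu setT by rewrite mul0r.
apply: radon_integral_near => //.
- by apply/bounded_fun_leP; exists `|c|.
- by move=> x; rewrite subrr normr0.
Qed.

Lemma radon_integral_le mu f1 f2 : finadd mu -> nonneg mu ->
  bounded_fun f1 -> bounded_fun f2 -> (forall x, f1 x <= f2 x) ->
  radon_integral mu f1 <= radon_integral mu f2.
Proof.
move=> fmu mu0 bf1 bf2 f12; apply/ler_addgt0Pl => e e0.
have m0 : 0 < (mu setT + 1) * 4 by rewrite mulr_gt0// ltr_wpDl.
have [e' e'0 ->] : exists2 e', 0 < e' & e = (mu setT + 1) * 4 * e'.
  exists (e / ((mu setT + 1) * 4)); first by rewrite divr_gt0.
  by rewrite mulrC divfK// gt_eqF.
have [g1 sg1 fg1] := simple_dense Td bf1 e'0.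
have [g2 sg2 fg2] := simple_dense Td bf2 e'0.
have := radon_integral_near fmu mu0 bf1 sg1 fg1.
have := radon_integral_near fmu mu0 bf2 sg2 fg2.
have : simple_integral mu g1 <= simple_integral mu g2 + (e' + e') * mu setT.
  apply: simple_integral_le => // x; have := f12 x; have := fg1 x; have := fg2 x.
  by rewrite !ler_norml; lra.
by rewrite !ler_norml => *; nra.
Qed.

End radon.

(** * The sum of the point masses *)

Section atomic.
Context (R : realType) (T : choiceType).
Context (mu : set T -> R) (fmu : finadd mu) (mu0 : forall E, 0 <= mu E).
Implicit Types (A B E : set T).

(** For nonnegative [mu] on an immeasurable space, this is its countably additive
component. *)
Definition atomic_part (mu : set T -> R) E : R :=
  fine (\esum_(x in E) (mu [set x])%:E).

Lemma esum_atoms_le E c : (forall F, finite_set F -> F `<=` E -> mu F <= c) ->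
  (\esum_(x in E) (mu [set x])%:E <= c%:E)%E.
Proof.
move=> muc; apply: ge_ereal_sup => _ [F [fF FE] <-].
by rewrite fsbig_finite// sumEFin -finadd_finiteE// lee_fin muc.
Qed.

Lemma atomic_partE E : (\esum_(x in E) (mu [set x])%:E = (atomic_part mu E)%:E)%E.
Proof.
rewrite /atomic_part fineK// ge0_fin_numE; last first.
  by apply: esum_ge0 => x _; rewrite lee_fin.
apply: le_lt_trans (esum_atoms_le (c := mu E) _) (ltry _) => F _ FE.
exact: finadd_le.
Qed.

Lemma atomic_part_bound E c :
  (forall F, finite_set F -> F `<=` E -> mu F <= c) -> atomic_part mu E <= c.
Proof. by move=> muc; rewrite -lee_fin -atomic_partE; exact: esum_atoms_le. Qed.

Lemma atomic_part_ge0 E : 0 <= atomic_part mu E.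
Proof.
by rewrite -lee_fin -atomic_partE; apply: esum_ge0 => x _; rewrite lee_fin.
Qed.

Lemma atomic_part_le E : atomic_part mu E <= mu E.
Proof. by apply: atomic_part_bound => F _ FE; exact: finadd_le. Qed.

Lemma atomic_part_set1 x : atomic_part mu [set x] = mu [set x].
Proof. by apply: EFin_inj; rewrite -atomic_partE esum_set1// lee_fin. Qed.

Lemma finadd_atomic_part : finadd (atomic_part mu).
Proof.
split=> [|A B AB]; first by rewrite /atomic_part esum_set0.
apply: EFin_inj; rewrite EFinD -!atomic_partE.
rewrite [LHS]esum_mkcond [X in (X + _)%E]esum_mkcond [X in (_ + X)%E]esum_mkcond.
rewrite -esumD; last 2 first.
- by move=> x _; case: ifP; rewrite ?lee_fin.
- by move=> x _; case: ifP; rewrite ?lee_fin.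
apply: eq_esum => x _; rewrite in_setU.
case: (boolP (x \in A)) => [/set_mem Ax|_] /=; last by rewrite add0e.
rewrite ifN ?adde0//; apply/negP => /set_mem Bx.
by have : (A `&` B) x by []; rewrite AB.
Qed.

End atomic.

(** * Invariant measures have no atoms *)

Section no_atoms.
Context (R : realType) (d : measure_display) (T : measurableType d).
Context (Td : discrete_sigma_algebra T) (Timm : immeasurable R T).
Context (P Pca Ppfa : T -> set T -> R) (q1 q2 : R).
Context (kerP : fa_markov_kernel P) (decP : kernel_decomposition P Pca Ppfa)
  (combP : combined Pca Ppfa q1 q2).
Implicit Types (mu nu : set T -> R) (A B E : set T).

Lemma kernel_bounded E : bounded_fun (P ^~ E).
Proof. by case: (fa_kernel_fun kerP E). Qed.

(** Finite sets do not see the purely finitely additive component. *)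
Lemma kernel_finite x G : finite_set G -> P x G = Pca x G.
Proof.
move=> fG; rewrite (kernel_decompE decP).
have [ba0 at0] := (pfaP Td _ Timm).1 (kernel_decomp_pfa decP x).
by rewrite (finadd_finite0 _ at0 fG) ?addr0//; have [] := (baP Td _).1 ba0.
Qed.

(** The component [Pca] is nonnegative because its point masses are those of
[P]; hence its value on [G] is at most its total mass. *)
Lemma kernel_finite_le x G : finite_set G -> P x G <= q1.
Proof.
move=> fG; rewrite kernel_finite// -(combined_ca combP x).
have caP := kernel_decomp_ca decP x.
have [fP _] := (baP Td _).1 (ca_ba Td caP).
apply: finadd_le => //; apply: (ca_ge0 Td caP Timm) => y.
by rewrite -kernel_finite; [have /andP[] := fa_kernel_itv kerP x [set y]|].
Qed.

(** The atoms of an invariant measure lose the factor [q1] at each step: the part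
without atoms cannot feed them, by the hypothesis on the component [Pca]. *)
Lemma invariant_pfa mu : q1 < 1 ->
  [set markov_operator Pca nu | nu in V (@pfa R d T)] `<=` V (@pfa R d T) ->
  invariant_measure P mu -> pfa mu.
Proof.
move=> q11 Apfa [bamu mu0 Amu].
have [fmu bmu] := (baP Td _).1 bamu.
pose at_mu := atomic_part mu; have fat := finadd_atomic_part fmu mu0.
have at0 : nonneg at_mu by exact: atomic_part_ge0.
pose pp E := mu E + -1 * at_mu E.
have fpp : finadd pp by apply: finaddD => //; exact: finaddZ.
have pp0 : nonneg pp.
  by move=> E; rewrite /pp mulN1r subr_ge0; exact: atomic_part_le.
have pp1 x : pp [set x] = 0 by rewrite /pp /at_mu atomic_part_set1// mulN1r subrr.
have muE : mu = fun E => at_mu E + pp E.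
  by apply/funext => E; rewrite /pp mulN1r addrC subrK.
(* The hypothesis on [Pca] is about measures of mass at most one, so [pp] is
   rescaled; adding 1 to the mass covers the case [pp = 0]. *)
have rpp G : finite_set G -> radon_integral pp (P ^~ G) = 0.
  move=> fG; have m0 : 0 < 1 + pp setT by rewrite ltr_pwDl.
  have c0 : 0 < (1 + pp setT)^-1 by rewrite invr_gt0.
  set c := (1 + pp setT)^-1 in c0.
  have : V (@pfa R d T) (fun E => c * pp E).
    split; last 2 first.
    - by move=> E; rewrite mulr_ge0 ?(ltW c0).
    - by rewrite mulrC ler_pdivrMr// mul1r lerDr.
    apply/(pfaP Td _ Timm); split; last by move=> x; rewrite pp1 mulr0.
    apply/(baP Td); split; first exact: finaddZ.
    apply/bounded_fun_leP; exists (c * pp setT) => E.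
    rewrite ger0_norm ?mulr_ge0 ?(ltW c0)//.
    by rewrite ler_wpM2l ?(ltW c0)// finadd_le.
  move=> Vpp; have [] : V (@pfa R d T) (markov_operator Pca (fun E => c * pp E)).
    by apply: Apfa; exists (fun E => c * pp E).
  move=> /(pfaP Td _ Timm)[/(baP Td)[fA _] A1] _ _.
  have := finadd_finite0 fA A1 fG; rewrite /markov_operator.
  have -> : (Pca ^~ G) = P ^~ G by apply/funext => x; rewrite kernel_finite.
  rewrite radon_integralZm ?(ltW c0)//; last exact: kernel_bounded.
  by move=> /eqP; rewrite mulf_eq0 gt_eqF//= => /eqP.
have muG G : finite_set G -> mu G <= q1 * at_mu setT.
  move=> fG; rewrite -Amu /markov_operator [X in radon_integral X]muE.
  rewrite radon_integralDm//; last exact: kernel_bounded.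
  rewrite rpp// addr0 -radon_integral_cst//; apply: radon_integral_le => //.
  - exact: kernel_bounded.
  - by apply/bounded_fun_leP; exists `|q1|.
  - by move=> x; exact: kernel_finite_le.
have atT : at_mu setT <= q1 * at_mu setT.
  by apply: atomic_part_bound => // F fF _; exact: muG.
have at00 : at_mu setT = 0 by have := at0 setT; nra.
apply/(pfaP Td _ Timm); split=> // x; apply/eqP; rewrite eq_le mu0 andbT.
rewrite -(atomic_part_set1 fmu mu0 x) -[X in _ <= X]at00.
exact: finadd_le.
Qed.

End no_atoms.

(** * Existence of an invariant probability *)

(** A cluster point of the image of an ultrafilter is its limit, and the interval
[[-M, M]] is compact. *)
Lemma ultra_cvg (R : realType) (I : Type) (U : set_system I) (u : I -> R) (M : R) :
  UltraFilter U -> (forall i, `|u i| <= M) -> cvg (u @ U).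
Proof.
move=> UU uM; have uU : (u @ U) [set` `[- M, M]].
  by apply: (@filterE _ U) => i /=; rewrite in_itv/= -ler_norml.
have [l [_ clu]] := @segment_compact R (- M) M (u @ U) _ uU.
apply/cvg_ex; exists l => /= B lB.
have [//|UnB] := in_ultra_setVsetC (u @^-1` B) UU.
by have [x [/= nBx Bx]] := clu (~` B) B UnB lB.
Qed.

Section existence.
Context (R : realType) (d : measure_display) (T : measurableType d).
Context (Td : discrete_sigma_algebra T).
Context (P : T -> set T -> R) (kerP : fa_markov_kernel P).
Implicit Types (mu nu : set T -> R) (A B E : set T).

Definition fa_probability mu := [/\ finadd mu, nonneg mu & mu setT = 1].

Lemma fa_probability_le1 mu E : fa_probability mu -> `|mu E| <= 1.
Proof. by move=> [fmu mu0 mu1]; rewrite ger0_norm// -mu1 finadd_le. Qed.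

Lemma fa_probability_dirac (a : T) : fa_probability (fun E => \1_E a).
Proof.
split=> [|E|]; last by rewrite indicE in_setT.
  split=> [|A B AB]; first by rewrite indicE in_set0.
  rewrite !indicE in_setU; case: (boolP (a \in A)) => [/set_mem Aa|_] /=.
    rewrite [a \in B]memNset ?addr0// => Ba.
    by have : (A `&` B) a by []; rewrite AB.
  by rewrite add0r.
by rewrite indicE; case: (_ \in _).
Qed.

Lemma markov_operator_probability mu :
  fa_probability mu -> fa_probability (markov_operator P mu).
Proof.
move=> [fmu mu0 mu1]; have bP E := kernel_bounded kerP E.
have PU A B x : A `&` B = set0 -> P x (A `|` B) = P x A + P x B.
  by move=> AB; have [[_ PU] _] := (baP Td _).1 (fa_kernel_ba kerP x); exact: PU.
have P0 x : P x set0 = 0.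
  by have [[P0 _] _] := (baP Td _).1 (fa_kernel_ba kerP x).
split; rewrite /markov_operator.
- split=> [|A B AB].
    rewrite (_ : P ^~ set0 = cst 0); last by apply/funext => x; rewrite P0.
    by rewrite radon_integral_cst// mul0r.
  rewrite -radon_integralD//; congr radon_integral.
  by apply/funext => x; rewrite PU.
- move=> E; rewrite -(mul0r (mu setT)) -radon_integral_cst//.
  apply: radon_integral_le => //.
    by apply/bounded_fun_leP; exists 0 => x; rewrite normr0.
  by move=> x; have /andP[] := fa_kernel_itv kerP x E.
- rewrite (_ : P ^~ setT = cst 1); last first.
    by apply/funext => x; rewrite (fa_kernel_mass kerP).
  by rewrite radon_integral_cst// mul1r.
Qed.

Definition orbit_sum mu n E := \sum_(k < n) iter k (markov_operator P) mu E.

Lemma orbit_probability mu k : fa_probability mu ->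
  fa_probability (iter k (markov_operator P) mu).
Proof. by move=> pmu; elim: k => // k; exact: markov_operator_probability. Qed.

Lemma orbit_sumS mu n :
  orbit_sum mu n.+1 = fun E => orbit_sum mu n E + iter n (markov_operator P) mu E.
Proof. by apply/funext => E; rewrite /orbit_sum big_ord_recr. Qed.

Lemma finadd_orbit_sum mu n : fa_probability mu ->
  finadd (orbit_sum mu n) /\ nonneg (orbit_sum mu n).
Proof.
move=> pmu; elim: n => [|n [fS S0]].
  split=> [|E]; last by rewrite /orbit_sum big_ord0.
  by split=> *; rewrite /orbit_sum !big_ord0 ?addr0.
have [fk k0 _] := orbit_probability n pmu.
by rewrite orbit_sumS; split=> [|E]; [exact: finaddD|rewrite addr_ge0].
Qed.

Lemma markov_operator_orbit_sum mu n E : fa_probability mu ->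
  markov_operator P (orbit_sum mu n) E = orbit_sum mu n.+1 E - mu E.
Proof.
move=> pmu; have bP := kernel_bounded kerP E.
elim: n => [|n IH].
  rewrite /orbit_sum big_ord1 subrr /markov_operator.
  rewrite (_ : (fun E => _) = fun E => 0 * mu E); last first.
    by apply/funext => F; rewrite big_ord0 mul0r.
  by have [fmu mu0 _] := pmu; rewrite radon_integralZm// mul0r.
have [fS S0] := finadd_orbit_sum n pmu; have [fk k0 _] := orbit_probability n pmu.
rewrite orbit_sumS /markov_operator radon_integralDm//.
rewrite [X in X + _]IH [in RHS]orbit_sumS.
by rewrite addrAC.
Qed.

Definition cesaro mu n E := n.+1%:R^-1 * orbit_sum mu n.+1 E.

Lemma cesaro_probability mu n : fa_probability mu -> fa_probability (cesaro mu n).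
Proof.
move=> pmu; have [fS S0] := finadd_orbit_sum n.+1 pmu.
split; [exact: finaddZ | by move=> E; rewrite mulr_ge0|].
rewrite /cesaro /orbit_sum (eq_bigr (fun=> 1)).
  by rewrite sumr_const card_ord mulVf// pnatr_eq0.
by move=> k _; have [_ _] := orbit_probability k pmu.
Qed.

(** The sums telescope: only the first and the last term of the orbit remain. *)
Lemma markov_operator_cesaro mu n E : fa_probability mu ->
  `|markov_operator P (cesaro mu n) E - cesaro mu n E| <= n.+1%:R^-1.
Proof.
move=> pmu; have [fS S0] := finadd_orbit_sum n.+1 pmu.
rewrite /markov_operator /cesaro radon_integralZm//; last exact: kernel_bounded.
rewrite -/(markov_operator P _ E) markov_operator_orbit_sum//.
rewrite orbit_sumS -mulrBr normrM ger0_norm// ler_piMr//.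
have [fk k0 k1] := orbit_probability n.+1 pmu; have [fmu mu0 mu1] := pmu.
have kE : iter n.+1 (markov_operator P) mu E <= 1 by rewrite -k1 finadd_le.
have muE : mu E <= 1 by rewrite -mu1 finadd_le.
have := k0 E; have := mu0 E.
by move=> *; rewrite ler_norml; apply/andP; split; lra.
Qed.

Section limit.
Context (U : set_system nat) (UU : UltraFilter U).
Context (nu_ : nat -> set T -> R) (pnu : forall n, fa_probability (nu_ n)).

Let nu E : R := lim (nu_ n E @[n --> U]).

Let nu_cvg E : nu_ n E @[n --> U] --> nu E.
Proof. by apply: (ultra_cvg (M := 1)) => n; exact: fa_probability_le1. Qed.

Lemma ultralimit_probability : fa_probability nu.
Proof.
split.
- split=> [|A B AB].
    apply: (cvg_lim (@Rhausdorff R)); rewrite (_ : (fun n => _) = cst 0).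
      exact: cvg_cst.
    by apply/funext => n; have [[]] := pnu n.
  apply: (cvg_lim (@Rhausdorff R)).
  rewrite (_ : (fun n => _) = (fun n => nu_ n A + nu_ n B)).
    exact: cvgD.
  by apply/funext => n; have [[_ nuU] _ _] := pnu n; rewrite nuU.
- move=> E; apply: (cvgr_to_ge (@nu_cvg E)); apply: filterE => n.
  by have [_ + _] := pnu n.
- apply: (cvg_lim (@Rhausdorff R)); rewrite (_ : (fun n => _) = cst 1).
    exact: cvg_cst.
  by apply/funext => n; have [] := pnu n.
Qed.

Lemma simple_integral_ultralimit g : simple_function g ->
  simple_integral (nu_ n) g @[n --> U] --> simple_integral nu g.
Proof.
move=> [_ /simple_enum[s us gs]]; rewrite -[g]/(id \o g).
have [fnu _ _] := ultralimit_probability.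
rewrite (simple_integralE _ fnu us gs).
rewrite (_ : (fun n => _) =
    (fun n => \sum_(v <- s) v * nu_ n (g @^-1` [set v]))); last first.
  by apply/funext => n; have [fn _ _] := pnu n; rewrite (simple_integralE _ fn us gs).
elim: s {us gs} => [|v s IH].
  rewrite big_nil (_ : (fun n => _) = cst 0); first exact: cvg_cst.
  by apply/funext => n; rewrite big_nil.
rewrite big_cons (_ : (fun n => _) = (fun n => v * nu_ n (g @^-1` [set v]) +
   \sum_(w <- s) w * nu_ n (g @^-1` [set w]))).
  by apply: cvgD => //; exact: cvgMl_tmp.
by apply/funext => n; rewrite big_cons.
Qed.

(** Pointwise convergence on sets gives convergence of integrals of simple
functions; the error in passing to [f] is at most [e] for all the [nu_ n] at
once, as they have total mass one. *)
Lemma radon_integral_ultralimit f L : bounded_fun f ->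
  radon_integral (nu_ n) f @[n --> U] --> L -> radon_integral nu f = L.
Proof.
move=> bf fL; have [fnu nu0 nu1] := ultralimit_probability.
apply: (@radon_integral_unique _ _ _ Td _ _ _ 1) => // e e0.
have [g sg fg] := simple_dense Td bf e0; exists g; split=> //.
apply: (cvgr_to_le (cvg_norm (cvgB fL (simple_integral_ultralimit sg)))).
apply: filterE => n; rewrite mulr1.
have [fn n0 n1] := pnu n.
by have := radon_integral_near Td fn n0 bf sg fg; rewrite n1 mulr1.
Qed.

End limit.

(** Any ultrafilter finer than the Frechet filter on [nat] serves: along it the
averages converge on each set and become invariant. *)
Lemma exists_invariant_probability (a : T) :
  exists2 nu, fa_probability nu & markov_operator P nu = nu.
Proof.
have [U [UU Uoo]] := ultraFilterLemma (_ : ProperFilter \oo).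
pose mu E : R := \1_E a; have pa : fa_probability mu := fa_probability_dirac a.
have pces n := cesaro_probability n pa.
exists (fun E => lim (cesaro mu n E @[n --> U])).
  exact: ultralimit_probability.
apply/funext => E; apply: (radon_integral_ultralimit UU pces).
  exact: kernel_bounded.
have cE : cesaro mu n E @[n --> U] --> lim (cesaro mu n E @[n --> U]).
  by apply: (ultra_cvg (M := 1)) => n; exact: fa_probability_le1.
rewrite -[X in _ --> X]addr0.
rewrite (_ : (fun n => _) = (fun n => cesaro mu n E +
  (markov_operator P (cesaro mu n) E - cesaro mu n E))); last first.
  by apply/funext => n; rewrite addrC subrK.
apply: cvgD => //; apply/cvgr0Pnorm_le => e e0; apply: Uoo.
have /cvgrPdist_le/(_ _ e0) := @cvg_harmonic R.
apply: filterS => n; rewrite sub0r normrN ger0_norm ?invr_ge0// => ne.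
exact: le_trans (markov_operator_cesaro n E pa) ne.
Qed.

End existence.

(** * Invariant measures of a combined chain *)

Theorem corollary5p3 (R : realType) (d : measure_display) (T : measurableType d)
    (Tinf : infinite_set [set: T])
    (Tdiscrete : discrete_sigma_algebra T)
    (Timm : immeasurable R T)
    (P Pca Ppfa : T -> set T -> R) (q1 q2 : R)
    (kerP : fa_markov_kernel P)
    (decP : kernel_decomposition P Pca Ppfa)
    (combP : combined Pca Ppfa q1 q2)
    (nondegP : non_degenerate q1 q2)
    (Apfa : [set markov_operator Pca mu | mu in V (@pfa R d T)]
              `<=` V (@pfa R d T)) :
  [/\ forall mu : set T -> R, invariant_measure P mu -> pfa mu,
      Delta P (@ba R d T) = Delta P (@pfa R d T),
      Delta P (@pfa R d T) !=set0
    & Delta P (@ca R d T) = set0].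
Proof.
have [[/andP[_ q11] _]] := nondegP.
have inv_pfa mu : invariant_measure P mu -> pfa mu.
  exact: (invariant_pfa Tdiscrete Timm kerP decP combP q11 Apfa).
split=> //.
- apply/seteqP; split=> mu [[Wmu mu0 mu1] muN0 Amu]; split=> //; split=> //.
    by apply: inv_pfa; split.
  by case: Wmu.
- have [a _] := infinite_setN0 Tinf.
  have [nu [fnu nu0 nu1] Anu] := exists_invariant_probability Tdiscrete kerP a.
  have banu : ba nu.
    apply/(baP Tdiscrete); split=> //; apply/bounded_fun_leP; exists 1 => E.
    exact: fa_probability_le1.
  exists nu; split=> //.
    by split=> //; [by apply: inv_pfa; split|rewrite nu1].
  by move=> nuE; move: nu1; rewrite nuE => /esym/eqP; rewrite oner_eq0.
- rewrite -subset0 => mu [[camu mu0 mu1] muN0 Amu].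
  apply: muN0; apply: (ca_eq0 Tdiscrete Timm camu).
  have bamu := ca_ba Tdiscrete camu.
  by have /(pfaP Tdiscrete _ Timm)[] := inv_pfa mu (And3 bamu mu0 Amu).
Qed.
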